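(* Given integers $d\ge 1$, $r\ge 2$ and $m\ge n$, where $n=T(r,d)=(r-1)(d+1)+1$, there is $N=N(d,m,r)\in\mathbb{N}$ such that every sequence of length $N$ of vectors in $\mathbb{R}^d$ in strong general position contains a subsequence $p_1,\dots,p_m$ of length $m$ with the following property. For every subsequence $p_{i_1},\dots,p_{i_n}$ (with $1\le i_1<\dots<i_n\le m$) its Tverberg partitions are exactly the rainbow partitions; that is, a partition $A_1,\dots,A_r$ of $[n]$ into $r$ non-empty parts is a Tverberg partition for $p_{i_1},\dots,p_{i_n}$ if and only if it is a rainbow partition.
   Context: Write $[n]=\{1,\dots,n\}$. A subsequence keeps the order of the indices. Tverberg partition: a partition $A_1,\dots,A_r$ of $[n]$ into $r$ non-empty parts is a Tverberg partition for points $x_1,\dots,x_n\in\mathbb{R}^d$ if $\bigcap_{\mu=1}^r \operatorname{conv}\{x_i: i\in A_\mu\}\neq\emptyset$. Rainbow partition: with $n=(r-1)(d+1)+1$, define blocks $B_s=\{(s-1)(r-1)+1,(s-1)(r-1)+2,\dots,s(r-1)+1\}$ for $s\in[d+1]$ (so each block has $r$ elements and consecutive blocks share exactly one element). A partition $A_1,\dots,A_r$ of $[n]$ is proper if $1\le|A_\mu|\le d+1$ for all $\mu$. A proper partition is rainbow if $|A_\mu\cap B_s|=1$ for all $\mu\in[r]$ and $s\in[d+1]$. Strong general position: a sequence of points $p_1,\dots,p_N\in\mathbb{R}^d$ is in strong general position if for every $k\ge 1$ and any $k$ pairwise disjoint subsets $C_1,\dots,C_k\subset[N]$, the affine hulls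 $H_j=\operatorname{aff}\{p_i: i\in C_j\}$ satisfy $d-\dim\big(\bigcap_{j=1}^k H_j\big)=\min\big(d+1,\ \sum_{j=1}^k(d-\dim H_j)\big)$, where $\dim\emptyset=-1$. *)

(* Defs.v *)
From mathcomp Require Import all_boot all_order all_algebra.
From mathcomp Require Import boolp classical_sets reals.
Set Implicit Arguments. Unset Strict Implicit. Unset Printing Implicit Defensive.
Import Order.TTheory GRing.Theory Num.Theory.
Local Open Scope ring_scope.

Section Hulls.
Local Open Scope classical_set_scope.
Variables (R : realType) (d N : nat) (p : 'I_N -> 'rV[R]_d).
Implicit Type C : {set 'I_N}.

(* The sums run over i in C only, so the values of w outside C are irrelevant;
   both hulls of the empty family are empty. *)
Definition aff_hull C : set 'rV[R]_d :=
  [set x | exists w : 'I_N -> R,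
     \sum_(i in C) w i = 1 /\ x = \sum_(i in C) w i *: p i].

Definition conv_hull C : set 'rV[R]_d :=
  [set x | exists w : 'I_N -> R,
     [/\ forall i, i \in C -> 0 <= w i,
         \sum_(i in C) w i = 1 &
         x = \sum_(i in C) w i *: p i]].

End Hulls.

Section Flats.
Local Open Scope classical_set_scope.
Variables (R : realType) (d : nat).

Definition flat (a : 'rV[R]_d) (V : {vspace 'rV[R]_d}) : set 'rV[R]_d :=
  [set x | x - a \in V].

(* The dimension of a flat is that of its direction space, and -1 for set0.
   A set that is neither empty nor a flat gets the junk value 0; this does not
   happen for affine hulls and their intersections. *)
Definition aff_dim (S : set 'rV[R]_d) : int :=
  if S == set0 then -1
  else (\dim (xget 0%VS [set V | exists a, S = flat a V]))%:Z.

Lemma aff_dim_set0 : aff_dim set0 = -1.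
Proof. by rewrite /aff_dim eqxx. Qed.

Lemma aff_dim_flat a V : aff_dim (flat a V) = (\dim V)%:Z.
Proof.
have aV b W : flat b W b by rewrite /flat /= subrr mem0v.
rewrite /aff_dim ifN; last by apply/eqP => /seteqP[/(_ a (aV a V))].
congr (\dim _)%:Z; apply: xget_unique; first by exists a.
move=> W [b E]; apply/vspaceP => v.
have ab : a - b \in W by have : flat b W a by rewrite -E.
have key x : (x - a \in V) = (x - b \in W).
  by apply/idP/idP => H; [have : flat b W x by rewrite -E
                         |have : flat a V x by rewrite E].
have := key (v + a); rewrite addrK => ->.
by rewrite -addrA rpredDr.
Qed.

(* Some of the C j may be empty: the condition then holds trivially,
   as aff_dim set0 = -1. *)
Definition strong_general_position N (p : 'I_N -> 'rV[R]_d) : Prop :=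
  forall (k : nat) (C : 'I_k -> {set 'I_N}), (1 <= k)%N ->
    (forall i j, i != j -> [disjoint C i & C j]%bool) ->
    d%:Z - aff_dim (\bigcap_(j in [set: 'I_k]) aff_hull p (C j)) =
    Num.min (d%:Z + 1) (\sum_(j < k) (d%:Z - aff_dim (aff_hull p (C j)))).

End Flats.

Definition tverberg_number (r d : nat) : nat := ((r - 1) * (d + 1) + 1)%N.

(* Partitions are unordered: a partition into r nonempty parts is a
   P : {set {set 'I_n}} with finset.partition P [set: 'I_n] and #|P| = r. *)
Definition tverberg_partition (R : realType) (d n : nat)
    (p : 'I_n -> 'rV[R]_d) (P : {set {set 'I_n}}) : Prop :=
  finset.partition P [set: 'I_n] /\
  (\bigcap_(A in [set` P]) conv_hull p A !=set0)%classic.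

Section Rainbow.
Variables r d : nat.
Local Notation n := (tverberg_number r d).
Implicit Type P : {set {set 'I_n}}.

(* Indices and blocks are counted from 0, so the s-th block is
   {s(r-1), ..., (s+1)(r-1)}. *)
Definition block (s : 'I_(d + 1)) : {set 'I_n} :=
  [set i : 'I_n | (s * (r - 1) <= i <= (s + 1) * (r - 1))%N].

Definition proper_partition P : bool :=
  finset.partition P [set: 'I_n] && [forall A in P, (1 <= #|A| <= d + 1)%N].

Definition rainbow_partition P : bool :=
  proper_partition P && [forall A in P, forall s, #|A :&: block s| == 1%N].

End Rainbow.

Definition increasing (m n : nat) (f : 'I_m -> 'I_n) : Prop :=
  {homo f : i j / (i < j)%N}.

(* Main.v *)
From mathcomp Require Import boolp classical_sets.
Require Import Defs.
From mathcomp Require Import all_boot all_order all_algebra.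
From mathcomp Require Import reals.
From mathcomp Require Import ring lra zify.

(** A long sequence of points in general position contains a subsequence that
is stretched: there are linear forms phi_0, ..., phi_d on R^(d+1), positive on
the lifts (1, x) of the points x of the subsequence, such that each ratio phi_(k+1) / phi_k grows by at least a prescribed factor K from one point
to the next.  The model is the moment curve with rapidly increasing parameters
and phi_k the k-th coordinate.  On a stretched sequence the largest of the
phi_k, even after each has been multiplied by a positive constant of one's
choice, is the only one that matters away from d breakpoints, and the position
of these breakpoints can be chosen freely; so all questions about convex
combinations become combinatorial.

Existence of the subsequence ([stretched_subsequence]).  By Ramsey's theorem
all (d+1)-minors of the lifted points have the same sign.  Take the first d
points a_1, ..., a_d and the last d points b_1, ..., b_d and let phi_k (x) be
the minor of a_1, ..., a_k, x, b_(k+1), ..., b_d.  The growth of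
phi_(k+1) / phi_k between x and y is then a cross ratio of the four points
a_(k+1), x, y, b_(k+1) in the plane obtained by dividing out the other d-1
points.  Whether this cross ratio is at least K can be made homogeneous by
Ramsey's theorem, and a long sequence on a line always has four points with
a large cross ratio ([widely_spaced_cross_ratio]).

Rainbow partitions are Tverberg partitions ([common_point]).  Scale the forms
so that phi_(k-1) and phi_k agree at the point shared by the k-th block and its
predecessor; then phi_k dominates on the k-th block.  By a count of dimensions
there are weights w, not all zero, for which the weighted sums of the lifted
points over all parts agree.  Apply phi_k: each part has a single point i in
the k-th block, and its contribution w_i phi_k (x_i) is, up to a small error,
the whole sum, so these contributions are nearly equal for all points of the
block.  Consecutive blocks share a point, hence all contributions are nearly
equal along the whole sequence; in particular all weights have the same sign.

Other partitions are not Tverberg partitions ([no_common_point]).  If a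
partition is not rainbow, some part misses some block.  Cutting the sequence
around this block leaves d+1 consecutive intervals each of which misses a
part: this block, and d intervals of r-1 points, too short to meet all r
parts.  Scale the forms so that phi_k dominates on the k-th interval.  For each
part A let psi_A be the sum of the phi_k, with coefficient 1 if A is not the
part missing from the k-th interval and -(r-1) if it is.  The psi_A sum to zero,
but psi_A is positive on the points of A, so that the convex hulls of the parts
have no common point. *)

Set Implicit Arguments. Unset Strict Implicit. Unset Printing Implicit Defensive.
Import Order.TTheory GRing.Theory Num.Theory.
Local Open Scope ring_scope.

(** * Ramsey's theorem *)

(** With a separate target size a c for each colour one can induct on the sum
of the targets: pass to a part of the tail on which the colour of x :: u is a
constant c, where x is the first element, and lower the target for c by one.  If
the induction then returns a set of colour c, x extends it to the full size. *)
Lemma ramsey_colour (C : finType) (k : nat) :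
    (forall m, exists N, forall (T : eqType) (col : seq T -> C) (s : seq T),
      (N <= size s)%N -> exists t c, [/\ subseq t s, size t = m &
        forall u, subseq u t -> size u = k -> col u = c]) ->
  forall a : C -> nat,
  exists N, forall (T : eqType) (col : seq T -> C) (s : seq T),
    (N <= size s)%N -> exists t c, [/\ subseq t s, size t = a c &
      forall u, subseq u t -> size u = k.+1 -> col u = c].
Proof.
move=> IHk a; have [w] := ubnP (\sum_c a c)%N; elim: w a => // w IHw a lt_a_w.
have [/existsP[c0 /eqP a0]|/existsPn a_gt0] := boolP [exists c, a c == 0%N].
  exists 0%N => T col s _; exists [::], c0; split=> //; first exact: sub0seq.
  by move=> u; rewrite subseq0 => /eqP->.
pose a' c := fun c' => (a c' - (c' == c))%N.
have /choice[N NP] : forall c, exists N, forall (T : eqType) (col : seq T -> C)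
    (s : seq T), (N <= size s)%N -> exists t c', [/\ subseq t s, size t = a' c c' &
      forall u, subseq u t -> size u = k.+1 -> col u = c'].
  move=> c; apply: IHw; rewrite ltnS in lt_a_w; apply: leq_trans lt_a_w.
  rewrite (bigD1 c) //= [X in (_ < X)%N](bigD1 c) //= /a' eqxx subn1.
  rewrite -addSn prednK ?lt0n ?a_gt0 // leq_add2l.
  by apply: leq_sum => i _; apply: leq_subr.
have [N1 N1P] := IHk (\max_c N c)%N.
exists N1.+1 => T col [|x s] //; rewrite ltnS => /(N1P T (fun u => col (x :: u))).
move=> [t [c [ts sz_t tc]]].
have le_N : (N c <= size t)%N by rewrite sz_t leq_bigmax.
have [t' [c' [t't sz_t' t'c]]] := NP c T col t le_N.
have t's : subseq t' s := subseq_trans t't ts.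
have [eq_c|neq_c] := eqVneq c' c; last first.
  exists t', c'; split=> //; last by rewrite sz_t' /a' (negPf neq_c) subn0.
  exact: subseq_trans t's (subseq_cons _ _).
exists (x :: t'), c'; split=> /=; first by rewrite eqxx.
  by rewrite sz_t' /a' eq_c eqxx subn1 prednK // lt0n a_gt0.
move=> [|y u] //=; case: eqP => [-> | _] u_t'; last exact: (t'c (y :: u)).
by case=> sz_u; rewrite eq_c; apply: tc => //; apply: subseq_trans t't.
Qed.

Lemma ramsey (C : finType) (k m : nat) :
  exists N, forall (T : eqType) (col : seq T -> C) (s : seq T),
    (N <= size s)%N -> exists t c, [/\ subseq t s, size t = m &
      forall u, subseq u t -> size u = k -> col u = c].
Proof.
elim: k m => [|k IHk] m; last exact: (ramsey_colour IHk (fun _ => m)).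
exists m => T col s le_m; exists (take m s), (col [::]); split.
- exact: take_subseq.
- by rewrite size_take_min; apply/minn_idPl.
- by move=> u _ /size0nil->.
Qed.

(** * Minors and cross ratios *)

Section Bracket.
Variables (R : fieldType) (d : nat).
Implicit Types (s A B : seq 'rV[R]_d.+1) (x y e f v : 'rV[R]_d.+1).

Definition bracket s : R := \det (\matrix_(i < d.+1) nth 0 s i).

(** The bracket is linear in the entry that follows A, and this is its
coefficient vector; the 0 only fills that row, which the cofactors ignore. *)
Definition bracket_fun A B : 'cV[R]_d.+1 :=
  \col_j cofactor (\matrix_(i < d.+1) nth 0 (A ++ 0 :: B) i) (inord (size A)) j.

Lemma bracketE A v B : (size A <= d)%N ->
  bracket (A ++ v :: B) = (v *m bracket_fun A B) 0 0.
Proof.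
move=> leA; have iA : (inord (size A) : 'I_d.+1) = size A :> nat by rewrite inordK.
rewrite /bracket (expand_det_row _ (inord (size A))) !mxE.
apply: eq_bigr => j _; rewrite !mxE iA nth_cat ltnn subnn /=; congr (_ * (_ * \det _)).
apply/matrixP=> i k; rewrite !mxE; congr (fun_of_matrix _ _ _).
set l := nat_of_ord (lift _ _); have : l != size A.
  by rewrite -iA /l eq_sym; apply: (neq_lift (inord (size A)) i).
rewrite !nth_cat; case: ltngtP => //= ltAl _.
by rewrite -(subnSK ltAl).
Qed.

Lemma bracket_dup s : size s = d.+1 -> ~~ uniq s -> bracket s = 0.
Proof.
move=> sz_s /(uniqPn 0)[i [j [ltij]]]; rewrite sz_s => ltjd eq_ij.
have ltid : (i < d.+1)%N by apply: ltn_trans ltjd.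
apply: (@determinant_alternate _ _ _ (Ordinal ltid) (Ordinal ltjd)).
  by rewrite -val_eqE /= neq_ltn ltij.
by move=> k; rewrite !mxE /= eq_ij.
Qed.

Lemma bracket_swap A B x y : (size A + size B).+1 = d ->
  bracket (A ++ x :: y :: B) = - bracket (A ++ y :: x :: B).
Proof.
move=> sz; have leA : (size A < d)%N by lia.
have D1 z z' t : bracket (A ++ (z + z') :: t :: B) =
    bracket (A ++ z :: t :: B) + bracket (A ++ z' :: t :: B).
  by rewrite !bracketE ?(ltnW leA) // mulmxDl mxE.
have D2 z z' t : bracket (A ++ t :: (z + z') :: B) =
    bracket (A ++ t :: z :: B) + bracket (A ++ t :: z' :: B).
  by rewrite -!(cat_rcons t) !bracketE ?size_rcons // mulmxDl mxE.
have alt z : bracket (A ++ z :: z :: B) = 0.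
  apply: bracket_dup; first by rewrite size_cat /= !addnS sz.
  by rewrite cat_uniq /= inE eqxx /= !andbF.
have := alt (x + y); rewrite D1 !D2 !alt add0r addr0 => /eqP.
by rewrite addr_eq0 => /eqP.
Qed.

(** The difference of the two sides is a linear form in y which vanishes on
A, e, f and B, and these vectors form a basis because br e f is nonzero. *)
Lemma bracket_plucker A B e f x y : (size A + size B).+1 = d ->
  let br u v := bracket (A ++ u :: v :: B) in
  br e f != 0 -> br e f * br x y = br x f * br e y - br e x * br y f.
Proof.
move=> sz br nz_ef; have leA : (size A < d)%N by lia.
have sz2 (u v : 'rV[R]_d.+1) : size (A ++ u :: v :: B) = d.+1.
  by rewrite size_cat /= !addnS sz.
have br1 u v : br u v = (u *m bracket_fun A (v :: B)) 0 0.
  by rewrite /br bracketE // ltnW.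
have br2 u v : br u v = (v *m bracket_fun (rcons A u) B) 0 0.
  by rewrite /br -cat_rcons bracketE // size_rcons.
have brN u v : br u v = - br v u by apply: bracket_swap.
have br0l u v : v \in A ++ B -> br v u = 0.
  move=> vAB; apply: bracket_dup => //; move: vAB; rewrite mem_cat cat_uniq /=.
  by rewrite inE; case/orP=> -> /=; rewrite ?orbT ?andbF.
have br0r u v : v \in A ++ B -> br u v = 0 by move=> vAB; rewrite brN br0l ?oppr0.
pose C := br e f *: bracket_fun (rcons A x) B - br x f *: bracket_fun (rcons A e) B
  + br e x *: bracket_fun A (f :: B).
have CE v : (v *m C) 0 0 = br e f * br x v - br x f * br e v + br e x * br v f.
  rewrite /C mulmxDr mulmxBr -!scalemxAr.
  by rewrite (br2 x v) (br2 e v) (br1 v f) !mxE.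
have C0 : C = 0.
  pose M := \matrix_(i < d.+1) nth 0 (A ++ e :: f :: B) i.
  have Munit : M \in unitmx by rewrite unitmxE unitfE.
  rewrite -[C](mulKmx Munit) (_ : M *m C = 0) ?mulmx0 //.
  apply/row_matrixP=> i; rewrite row_mul rowK row0; apply/matrixP=> a b.
  rewrite !ord1 CE mxE.
  have : nth 0 (A ++ e :: f :: B) i \in A ++ e :: f :: B by rewrite mem_nth ?sz2.
  move: (nth _ _ _) => v.
  have -> : (v \in A ++ e :: f :: B) = [|| v \in A ++ B, v == e | v == f].
    by rewrite !mem_cat !inE; do !case: (_ \in _); do !case: (_ == _).
  case/or3P=> [vAB|/eqP->|/eqP->].
  - by rewrite (br0r x v) // (br0r e v) // (br0l f v) // !mulr0 subr0 addr0.
  - rewrite (brN x e) (_ : br e e = 0); last first.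
      apply: bracket_dup => //.
      by rewrite cat_uniq /= inE eqxx /= !andbF.
    by rewrite mulr0 subr0 mulrN mulrC addNr.
  - rewrite (_ : br f f = 0); last first.
      apply: bracket_dup => //.
      by rewrite cat_uniq /= inE eqxx /= !andbF.
    by rewrite mulr0 addr0 mulrC subrr.
have := CE y; rewrite C0 mulmx0 mxE => /esym/eqP.
by rewrite addr_eq0 subr_eq => /eqP->; rewrite addrC.
Qed.

End Bracket.

Section CrossRatio.
Variable R : realFieldType.

(** The Plucker relation says that D is, up to positive factors, the difference
of the coordinates t i = D 0 i / D i M on a line where 0 has coordinate 0 and M
lies at infinity.  Put L = M - 1 and u i = t L - t i, and suppose that all cross
ratios are less than K.  Those of (i, i+1, L, M) give u i < K (u i - u (i+1)),
and those of (0, 1, i, L) give u 1 < K (u i), so that u drops by at least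
u 1 / K^2 at each step.  After K^2 steps it would no longer be positive. *)
Lemma widely_spaced_cross_ratio (K M : nat) (D : nat -> nat -> R) :
    (0 < K)%N -> (K ^ 2 + 3 <= M)%N ->
    (forall i j, (i < j <= M)%N -> 0 < D i j) ->
    (forall i j, (0 < i)%N -> (i < j)%N -> (j < M)%N ->
       D 0%N M * D i j = D i M * D 0%N j - D 0%N i * D j M) ->
  exists a x y b, [/\ (a < x < y)%N, (y < b <= M)%N &
    K%:R * (D a x * D y b) <= D a y * D x b].
Proof.
move=> K0 leM Dgt0 pl; apply: contrapT => noex.
have small a x y b : (a < x < y)%N -> (y < b <= M)%N ->
    D a y * D x b < K%:R * (D a x * D y b).
  by move=> h1 h2; rewrite ltNge; apply/negP => h; apply: noex; exists a, x, y, b.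
pose L := M.-1; pose s i := D i M; pose t i := D 0%N i / D i M.
have sgt0 i : (i < M)%N -> 0 < s i by move=> ?; rewrite Dgt0 // leqnn andbT.
have D0 i : (i < M)%N -> D 0%N i = t i * s i.
  by move=> lti; rewrite /t divfK // gt_eqF // sgt0.
have DE i j : (0 < i)%N -> (i < j)%N -> (j < M)%N ->
    D i j = (t j - t i) * (s i * s j / D 0%N M).
  move=> i0 ij jM; have iM := ltn_trans ij jM.
  have DM : 0 < D 0%N M by apply: Dgt0; lia.
  apply: (mulfI (lt0r_neq0 DM)); rewrite pl // (D0 i) // (D0 j) // -/(s i) -/(s j).
  by field; rewrite gt_eqF.
have DM : 0 < D 0%N M by apply: Dgt0; lia.
have tincr i j : (0 < i)%N -> (i < j)%N -> (j < M)%N -> t i < t j.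
  move=> i0 ij jM; have iM := ltn_trans ij jM.
  have Dij : 0 < D i j by apply: Dgt0; lia.
  have h : 0 < s i * s j / D 0%N M by apply: divr_gt0 DM; apply: mulr_gt0; apply: sgt0.
  by move: Dij; rewrite DE // pmulr_lgt0 // subr_gt0.
have tgt0 i : (0 < i)%N -> (i < M)%N -> 0 < t i.
  by move=> i0 iM; rewrite divr_gt0 ?sgt0 //; apply: Dgt0; lia.
have LM : (L < M)%N by rewrite /L; lia.
pose u i := t L - t i.
have gap i : (0 < i)%N -> (i.+1 < L)%N -> u i < K%:R * (u i - u i.+1).
  move=> i0 iL.
  have /= := small i i.+1 L M; rewrite -/(s i.+1) -/(s L) (DE i L) ?(DE i i.+1) //; try lia.
  move=> /(_ ltac:(lia) ltac:(lia)).
  have h : 0 < s i * s L * s i.+1 / D 0%N M by rewrite divr_gt0 ?mulr_gt0 ?sgt0 //; lia.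
  rewrite -(ltr_pM2r h (u i)) /u => H; lra.
have low i : (1 < i)%N -> (i < L)%N -> u 1%N < K%:R * u i.
  move=> i1 iL.
  have /= := small 0%N 1%N i L; rewrite (D0 i) ?(D0 1%N) ?(DE 1%N L) ?(DE i L) //; try lia.
  move=> /(_ ltac:(lia) ltac:(lia)).
  have h : 0 < s i * s L * s 1%N / D 0%N M by rewrite divr_gt0 ?mulr_gt0 ?sgt0 //; lia.
  have H1 : t i * s i * ((t L - t 1%N) * (s 1%N * s L / D 0%N M)) =
            t i * u 1%N * (s i * s L * s 1%N / D 0%N M) by rewrite /u; ring.
  have H2 : K%:R * (t 1%N * s 1%N * ((t L - t i) * (s i * s L / D 0%N M))) =
            t 1%N * (K%:R * u i) * (s i * s L * s 1%N / D 0%N M) by rewrite /u; ring.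
  rewrite H1 H2 ltr_pM2r // => H.
  have t1 : 0 < t 1%N by apply: tgt0 => //; lia.
  rewrite -(ltr_pM2l t1); apply: le_lt_trans H; rewrite ler_pM2r ?ltW ?tincr //; first lia.
  by rewrite /u subr_gt0 tincr //; lia.
have K2 : 0 < K%:R ^+ 2 :> R by rewrite exprn_gt0 // ltr0n.
have dec i : (0 < i)%N -> (i.+1 < L)%N -> u 1%N <= K%:R ^+ 2 * (u i - u i.+1).
  move=> i0 iL; have := gap i i0 iL; rewrite -(ltr_pM2l (_ : 0 < K%:R :> R)) ?ltr0n //.
  rewrite mulrA -expr2 => /ltW; apply: le_trans.
  have [->|i1] := eqVneq i 1%N; last by apply/ltW/low; lia.
  rewrite ler_peMl ?ler1n // ltW // subr_gt0 tincr //; lia.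
have sum i : (i.+1 < L)%N -> i%:R * u 1%N <= K%:R ^+ 2 * (u 1%N - u i.+1).
  elim: i => [|i IH] iL; first by rewrite mul0r subrr mulr0.
  have := IH (ltnW iL); have := dec i.+1 isT iL.
  rewrite -natr1; lra.
have := sum (K ^ 2)%N; rewrite natrX ler_pM2l //.
have : 0 < u (K ^ 2).+1 by rewrite subr_gt0 tincr //; rewrite /L; lia.
rewrite /L; move=> h /(_ ltac:(lia)); lra.
Qed.
End CrossRatio.

(** * Stretched subsequences *)

Lemma sorted_ltn_cat (s1 s2 : seq nat) :
    sorted ltn s1 -> sorted ltn s2 -> (forall x y, x \in s1 -> y \in s2 -> (x < y)%N) ->
  sorted ltn (s1 ++ s2).
Proof.
rewrite !(sorted_pairwise ltn_trans) pairwise_cat => -> -> lt12; rewrite !andbT.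
by apply/allrelP => x y xs ys; apply: lt12.
Qed.

Lemma subseq_nth (T : eqType) (x0 : T) (s : seq T) (js : seq nat) :
    sorted ltn js -> all (gtn (size s)) js ->
  subseq [seq nth x0 s j | j <- js] s.
Proof.
move=> sorted_js /allP lt_js; rewrite -[X in subseq _ X](mkseq_nth x0) /mkseq.
apply: map_subseq; rewrite (_ : js = filter [in js] (iota 0 (size s))) ?filter_subseq //.
apply: (irr_sorted_eq ltn_trans ltnn) => // [|i].
  exact/(sorted_filter ltn_trans)/iota_ltn_sorted.
rewrite mem_filter mem_iota /= add0n.
by case: (boolP (i \in js)) => // /lt_js /= ->.
Qed.

Section Stretched.
Variables (R : realFieldType) (d : nat).

Definition ev (phi : 'cV[R]_d.+1) (x : 'rV[R]_d.+1) : R := (x *m phi) 0 0.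

(** With v = A ++ [:: a, x, y, b & B] and A of size k, this says that the cross
ratio of a, x, y, b is at least K modulo the span of A and B. *)
Definition wide (K k : nat) (v : seq 'rV[R]_d.+1) : bool :=
  let br x y := bracket (take k v ++ x :: y :: drop (k + 4) v) in
  K%:R * (br v`_k v`_(k + 1) * br v`_(k + 2) v`_(k + 3)) <=
    br v`_k v`_(k + 2) * br v`_(k + 1) v`_(k + 3).

(** Ramsey's theorem is used for the signs of the brackets, then for the d
comparisons [wide K k] at once.  The second use asks for m + 1 points only to
have a default value for the enumeration Y. *)
Lemma homogeneous_subsequence (K m : nat) :
  exists N, forall X : 'I_N -> 'rV[R]_d.+1,
    (forall u, uniq u -> size u = d.+1 -> bracket (map X u) != 0) ->
  exists Y : nat -> 'I_N, [/\ forall i j, (i < j < m)%N -> (Y i < Y j)%N,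
    exists e : R, forall js, sorted ltn js -> all (gtn m) js -> size js = d.+1 ->
      0 < e * bracket [seq X (Y j) | j <- js] &
    exists c : 'I_d -> bool, forall js, sorted ltn js -> all (gtn m) js ->
      size js = (d + 3)%N -> forall k : 'I_d, wide K k [seq X (Y j) | j <- js] = c k].
Proof.
have [N2 N2P] := ramsey {ffun 'I_d -> bool} (d + 3) m.+1.
have [N1 N1P] := ramsey bool d.+1 N2.
exists N1 => X gp.
have [t1 [c1 [t1s sz_t1 t1c]]] := N1P _ (fun u => 0 < bracket (map X u))
  (enum 'I_N1) (eq_leq (esym (size_enum_ord N1))).
have [t2 [c2 [t2t1 sz_t2 t2c]]] := N2P _
  (fun u => [ffun k : 'I_d => wide K k (map X u)]) t1 (eq_leq (esym sz_t1)).
have t2s := subseq_trans t2t1 t1s.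
have x0 : 'I_N1 by case: (t2) sz_t2.
have sub js : sorted ltn js -> all (gtn m) js -> subseq [seq nth x0 t2 j | j <- js] t2.
  move=> sjs /allP ajs; apply: subseq_nth => //; apply/allP=> j /ajs /=.
  by rewrite sz_t2 => /leqW.
exists (nth x0 t2); split.
- move=> i j /andP[ij jm].
  have : sorted (fun x y : 'I_N1 => (x < y)%N) t2.
    apply: (subseq_sorted _ t2s) => [x y z|]; first exact: ltn_trans.
    by have := iota_ltn_sorted 0 N1; rewrite -val_enum_ord sorted_map.
  move=> srt; apply: (sorted_ltn_nth _ x0 srt) => //.
  - by move=> x y z; apply: ltn_trans.
  - by rewrite inE sz_t2 ltnS ltnW // (ltn_trans ij).
  - by rewrite inE sz_t2 ltnS ltnW.
- exists (if c1 then 1 else -1) => js sjs ajs sz_js; have st2 := sub js sjs ajs.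
  pose u := [seq nth x0 t2 j | j <- js].
  have := t1c u (subseq_trans st2 t2t1); have := gp u.
  rewrite (subseq_uniq (subseq_trans st2 t2s) (enum_uniq _)) /u size_map -map_comp.
  move=> /(_ isT sz_js) nz /(_ sz_js) <-; case: ifPn; first by rewrite mul1r.
  by rewrite -leNgt le_eqVlt (negPf nz) /= mulN1r oppr_gt0.
- exists c2 => js sjs ajs sz_js k.
  rewrite -(t2c _ (sub js sjs ajs)) ?size_map // ffunE -map_comp.
  by [].
Qed.

Lemma wide_cat (K : nat) (A B : seq 'rV[R]_d.+1) a x y b :
  let br u v := bracket (A ++ u :: v :: B) in
  wide K (size A) (A ++ [:: a, x, y, b & B]) =
    (K%:R * (br a x * br y b) <= br a y * br x b).
Proof.
rewrite /wide take_size_cat // !nth_cat ltnn subnn.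
have nlt i : (size A + i < size A)%N = false by apply/negbTE; lia.
by rewrite !nlt !addKn drop_cat nlt addKn /= drop0.
Qed.

(** The ratio of consecutive forms grows by a factor K from each point to every
later one. *)
Definition stretched (K n : nat) (X : 'I_n -> 'rV[R]_d.+1)
    (phi : nat -> 'cV[R]_d.+1) : Prop :=
  (forall k i, (k <= d)%N -> 0 < ev (phi k) (X i)) /\
  (forall k (i j : 'I_n), (k < d)%N -> (i < j)%N ->
     K%:R * (ev (phi k.+1) (X i) * ev (phi k) (X j)) <=
       ev (phi k.+1) (X j) * ev (phi k) (X i)).

(** The constant truth value of [wide K k] must be true, for otherwise K^2 + 4
consecutive points would contradict [widely_spaced_cross_ratio].  Applied to
the first d and the last d points and two points between them, it is the growth
condition for the forms described at the top. *)
Lemma stretched_subsequence (K m : nat) : (0 < K)%N ->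
  exists N, forall X : 'I_N -> 'rV[R]_d.+1,
    (forall u, uniq u -> size u = d.+1 -> bracket (map X u) != 0) ->
  exists f : 'I_m -> 'I_N, increasing f /\ exists phi, stretched K (X \o f) phi.
Proof.
move=> K0; pose M := (K ^ 2 + 3)%N.
have M0 : (0 < M <= M)%N by rewrite leqnn andbT /M addn3.
(* d points on either side of the m chosen ones for the forms, and room for M + 1
   points between the d - 1 that are divided out. *)
have [N NP] := homogeneous_subsequence K (m + d + d + M.+1).
exists N => X /NP[Y [Ymono [e epos] [c cP]]].
have cT (k : 'I_d) : c k.
  pose A := iota 0 k; pose B := iota (k + M.+1) (d - k.+1).
  pose br u v := bracket (map (X \o Y) A ++ u :: v :: map (X \o Y) B).
  have szAB : (size (map (X \o Y) A) + size (map (X \o Y) B)).+1 = d.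
    by rewrite !size_map !size_iota; have := ltn_ord k; lia.
  have sB : sorted ltn B by apply: iota_ltn_sorted.
  have sA : sorted ltn A by apply: iota_ltn_sorted.
  have Dgt0 i j : (i < j <= M)%N -> 0 < e * br (X (Y (k + i)%N)) (X (Y (k + j)%N)).
    move=> ijM; have := epos (A ++ [:: (k + i)%N, (k + j)%N & B]).
    rewrite map_cat; apply.
    - apply: sorted_ltn_cat => //.
        rewrite (_ : _ :: _ = [:: (k + i)%N; (k + j)%N] ++ B) //.
        apply: sorted_ltn_cat => //=; first by lia.
        by move=> x y; rewrite !inE mem_iota; lia.
      by move=> x y; rewrite !inE !mem_iota; lia.
    - apply/allP=> x; rewrite mem_cat !inE !mem_iota /=.
      by have := ltn_ord k; lia.
    - by rewrite size_cat /= !size_iota; have := ltn_ord k; lia.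
  have e0 : e != 0.
    by have := Dgt0 0%N M M0; apply: contraTneq => ->; rewrite mul0r ltxx.
  have [i j i0 ij jM|a [x [y [b [axy ybM]]]]] :=
      @widely_spaced_cross_ratio R K M (fun i j => e * br (X (Y (k + i)%N)) (X (Y (k + j)%N)))
        K0 (leqnn _) Dgt0.
    have nz : br (X (Y (k + 0)%N)) (X (Y (k + M)%N)) != 0.
      by have := Dgt0 0%N M M0; apply: contraTneq => ->; rewrite mulr0 ltxx.
    have := bracket_plucker (X (Y (k + i)%N)) (X (Y (k + j)%N)) szAB nz.
    rewrite -!/(br _ _) => H.
    have := congr1 (fun t => e * e * t) H; cbv beta; rewrite mulrBr; lra.
  have e2 : 0 < e * e by rewrite -expr2 exprn_even_gt0.
  have E (r s t w : R) :
      (K%:R * (e * r * (e * s)) <= e * t * (e * w)) = (K%:R * (r * s) <= t * w).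
    by rewrite -[RHS](ler_pM2l e2); congr (_ <= _); ring.
  rewrite E => ok.
  rewrite -(cP (A ++ [:: (k + a)%N, (k + x)%N, (k + y)%N, (k + b)%N & B])).
  - have := @wide_cat K (map (X \o Y) A) (map (X \o Y) B) (X (Y (k + a)%N))
      (X (Y (k + x)%N)) (X (Y (k + y)%N)) (X (Y (k + b)%N)).
    by rewrite size_map size_iota map_cat /= => ->.
  - apply: sorted_ltn_cat => //.
      rewrite (_ : _ :: _ = [:: (k + a)%N; (k + x)%N; (k + y)%N; (k + b)%N] ++ B) //.
      apply: sorted_ltn_cat => //=; first by lia.
      by move=> x' y'; rewrite !inE mem_iota; lia.
    by move=> x' y'; rewrite !inE !mem_iota; lia.
  - apply/allP=> x'; rewrite mem_cat !inE !mem_iota /=.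
    by have := ltn_ord k; lia.
  - by rewrite size_cat /= !size_iota; have := ltn_ord k; lia.
exists (fun i : 'I_m => Y (d + i)%N); split.
  by move=> i j ij; apply: Ymono; have := ltn_ord j; lia.
pose P k := iota 0 k; pose Q k := iota (d + m + k) (d - k).
exists (fun k => e *: bracket_fun (map (X \o Y) (P k)) (map (X \o Y) (Q k))).
have phiE k v : (k <= d)%N ->
    ev (e *: bracket_fun (map (X \o Y) (P k)) (map (X \o Y) (Q k))) v =
    e * bracket (map (X \o Y) (P k) ++ v :: map (X \o Y) (Q k)).
  by move=> kd; rewrite /ev -scalemxAr mxE bracketE // size_map size_iota.
split=> [k i kd|k i j kd ij].
  rewrite phiE //; have := epos (P k ++ (d + i)%N :: Q k); rewrite map_cat; apply.
  - have sQ : sorted ltn (Q k) by apply: iota_ltn_sorted.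
    apply: sorted_ltn_cat; first exact: iota_ltn_sorted.
      rewrite -cat1s; apply: sorted_ltn_cat => // x y; rewrite !inE !mem_iota.
      by have := ltn_ord i; lia.
    by move=> x y; rewrite !inE !mem_iota; have := ltn_ord i; lia.
  - by apply/allP=> x; rewrite mem_cat !inE !mem_iota /=; have := ltn_ord i; lia.
  - by rewrite size_cat /= !size_iota; lia.
rewrite [(X \o _) i]/= [(X \o _) j]/=.
pose B := iota (d + m + k.+1) (d - k.+1).
rewrite !phiE ?(ltnW kd) //.
have -> : Q k = (d + m + k)%N :: B.
  by rewrite /Q /B (_ : (d - k)%N = (d - k.+1).+1) 1?addnS //; lia.
have -> : P k.+1 = rcons (P k) k by rewrite /P -addn1 iotaD -cats1.
rewrite map_rcons !cat_rcons -/B.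
have := cT (Ordinal kd).
rewrite -(cP (P k ++ [:: k, (d + i)%N, (d + j)%N, (d + m + k)%N & B])) /=; first last.
- by rewrite size_cat /= !size_iota; lia.
- by apply/allP=> x; rewrite mem_cat !inE !mem_iota /=; have := ltn_ord j; lia.
- have sQ : sorted ltn B by apply: iota_ltn_sorted.
  apply: sorted_ltn_cat; first exact: iota_ltn_sorted.
    rewrite (_ : _ :: _ = [:: k; (d + i)%N; (d + j)%N; (d + m + k)%N] ++ B) //.
    apply: sorted_ltn_cat => //=; first by have := ltn_ord j; lia.
    by move=> x y; rewrite !inE !mem_iota; have := ltn_ord j; lia.
  by move=> x y; rewrite !inE !mem_iota; have := ltn_ord j; lia.
have := @wide_cat K (map (X \o Y) (P k)) (map (X \o Y) B) (X (Y k)) (X (Y (d + i)%N))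
  (X (Y (d + j)%N)) (X (Y (d + m + k)%N)).
rewrite size_map size_iota map_cat /= => ->.
move=> H.
have e2 : 0 <= e * e by rewrite -expr2 sqr_ge0.
have := ler_wpM2l e2 H; lra.
Qed.

End Stretched.

(** * Weights and scalings *)

(** Equality with the sum over A0 is a homogeneous system with D equations for
each of the other parts, hence fewer equations than unknowns. *)
Lemma common_weighted_sum (F : fieldType) (n D : nat) (y : 'I_n -> 'rV[F]_D)
    (P : {set {set 'I_n}}) (A0 : {set 'I_n}) :
    A0 \in P -> (#|P|.-1 * D < n)%N ->
  exists w : 'I_n -> F, (exists i, w i != 0) /\
    forall A, A \in P -> \sum_(i in A) w i *: y i = \sum_(i in A0) w i *: y i.
Proof.
move=> A0P ltn; pose E := setX (P :\ A0) [set: 'I_D].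
have cE : #|E| = (#|P|.-1 * D)%N.
  by rewrite cardsX cardsT card_ord (cardsD1 A0 P) A0P.
pose M : 'M[F]_(n, #|E|) := \matrix_(i < n, e < #|E|)
  let: (A, k) := enum_val e in ((i \in A)%:R - (i \in A0)%:R) * y i 0 k.
have /rowV0Pn[v /sub_kermxP vM v0] : kermx M != 0.
  rewrite -mxrank_eq0 mxrank_ker -lt0n subn_gt0.
  by apply: leq_ltn_trans (rank_leq_col _) _; rewrite cE.
exists (v 0); split; first by have /rV0Pn := v0.
move=> A AP; have [->//|neq] := eqVneq A A0.
apply/rowP => k; have eE : (A, k) \in E by rewrite !inE neq AP.
have /rowP/(_ (enum_rank_in eE (A, k))) := vM.
rewrite !mxE (eq_bigr (fun i => (i \in A)%:R * (v 0 i * y i 0 k) -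
  (i \in A0)%:R * (v 0 i * y i 0 k))); last first.
  by move=> i _; rewrite mxE enum_rankK_in //=; ring.
rewrite sumrB => /eqP; rewrite subr_eq0 => /eqP H.
have S (B : {set 'I_n}) : (\sum_(i in B) v 0 i *: y i) 0 k =
    \sum_i (i \in B)%:R * (v 0 i * y i 0 k).
  rewrite summxE big_mkcond; apply: eq_bigr => i _; rewrite mxE.
  by case: (i \in B); rewrite ?mul1r ?mul0r.
by rewrite !S.
Qed.

Lemma chain_le (R : numDomainType) (g : nat -> R) (k j : nat) : (k <= j)%N ->
  (forall l, (k <= l < j)%N -> g l.+1 <= g l) -> g j <= g k.
Proof.
elim: j => [|j IH]; first by rewrite leqn0 => /eqP->.
rewrite leq_eqVlt => /predU1P[->//|kj] H.
apply: le_trans (H j _) (IH kj _); first by rewrite -ltnS kj /=.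
by move=> l /andP[kl lj]; apply: H; rewrite kl ltnW.
Qed.

Lemma chain_ge (R : numDomainType) (g : nat -> R) (k j : nat) : (k <= j)%N ->
  (forall l, (k <= l < j)%N -> g l <= g l.+1) -> g k <= g j.
Proof.
move=> kj H; rewrite -lerN2.
by apply: (@chain_le R (fun l => - g l)) => // l /H; rewrite lerN2.
Qed.

Section Rescale.
Variables (R : realFieldType) (n d : nat) (K : R) (h : nat -> 'I_n -> R).
Hypothesis h_gt0 : forall k i, (k <= d)%N -> 0 < h k i.
Hypothesis h_wide : forall k (i j : 'I_n), (k < d)%N -> (i < j)%N ->
  K * (h k.+1 i * h k j) <= h k.+1 j * h k i.

(** Scaling the forms one after the other makes the ratio of the forms of index
l+1 and l equal to c at the point b l; the growth of this ratio then bounds it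
before and after b l. *)
Lemma rescale (b : nat -> 'I_n) (c : R) : 0 < c ->
  exists lam : nat -> R, (forall k, (k <= d)%N -> 0 < lam k) /\
    forall l (i : 'I_n), (l < d)%N ->
    [/\ i = b l -> lam l.+1 * h l.+1 i = c * (lam l * h l i),
        (i < b l)%N -> K * (lam l.+1 * h l.+1 i) <= c * (lam l * h l i) &
        (b l < i)%N -> K * (c * (lam l * h l i)) <= lam l.+1 * h l.+1 i].
Proof.
move=> c0; pose lam k := \prod_(l < k) (c * h l (b l) / h l.+1 (b l)).
have lam_gt0 k : (k <= d)%N -> 0 < lam k.
  move=> kd; apply: prodr_gt0 => l _; have ld := leq_trans (ltn_ord l) kd.
  by rewrite divr_gt0 ?mulr_gt0 ?h_gt0 // ltnW.
exists lam; split=> // l i ld.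
have lamS : lam l.+1 = lam l * c * (h l (b l) / h l.+1 (b l)).
  by rewrite /lam big_ord_recr /=; ring.
have h0 := h_gt0 (b l) (ltnW ld); have h1 := h_gt0 (b l) ld.
have lc : 0 < lam l * c by rewrite mulr_gt0 // lam_gt0 // ltnW.
set t := h l (b l) / h l.+1 (b l) in lamS.
have tE : t * h l.+1 (b l) = h l (b l) by rewrite /t divfK ?gt_eqF.
split=> [->|lti|lti]; rewrite lamS.
- by rewrite -mulrA tE; ring.
- rewrite -(ler_pM2r h1).
  have -> : K * (lam l * c * t * h l.+1 i) * h l.+1 (b l) =
      lam l * c * (K * (h l.+1 i * (t * h l.+1 (b l)))) by ring.
  have -> : c * (lam l * h l i) * h l.+1 (b l) = lam l * c * (h l.+1 (b l) * h l i) by ring.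
  by rewrite tE ler_pM2l ?h_wide.
- rewrite -(ler_pM2r h1).
  have -> : K * (c * (lam l * h l i)) * h l.+1 (b l) =
      lam l * c * (K * (h l.+1 (b l) * h l i)) by ring.
  have -> : lam l * c * t * h l.+1 i * h l.+1 (b l) =
      lam l * c * (h l.+1 i * (t * h l.+1 (b l))) by ring.
  by rewrite tE ler_pM2l ?h_wide.
Qed.

End Rescale.

Section Homogenize.
Variables (R : realType) (d : nat).

Definition homog (x : 'rV[R]_d) : 'rV[R]_d.+1 := row_mx (const_mx 1 : 'rV_1) x.

Lemma homog_sum (I : finType) (A : {set I}) (w : I -> R) (x : I -> 'rV[R]_d) :
  \sum_(i in A) w i *: homog (x i) =
    row_mx (const_mx (\sum_(i in A) w i) : 'rV_1) (\sum_(i in A) w i *: x i).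
Proof.
have E (v : 'rV[R]_(1 + d)) a y : lsubmx v = const_mx a -> rsubmx v = y ->
    v = row_mx (const_mx a) y by move=> <- <-; rewrite hsubmxK.
apply: E; rewrite linear_sum /=.
  rewrite (eq_bigr (fun i => const_mx (w i))); last first.
    move=> i _; rewrite linearZ /= /homog row_mxKl.
    by apply/matrixP=> a b; rewrite !mxE mulr1.
  by apply/matrixP=> a b; rewrite summxE mxE; apply: eq_bigr => i _; rewrite mxE.
by apply: eq_bigr => i _; rewrite linearZ /= /homog row_mxKr.
Qed.

Lemma ev_sum (phi : 'cV[R]_d.+1) (I : finType) (A : {set I}) (w : I -> R) y :
  ev phi (\sum_(i in A) w i *: y i) = \sum_(i in A) w i * ev phi (y i).
Proof.
rewrite /ev mulmx_suml summxE; apply: eq_bigr => i _.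
by rewrite -scalemxAl mxE.
Qed.

End Homogenize.

Arguments homog {R d} x.

(** * Partitions that miss a block *)

Lemma card_interval (n a b : nat) : (#|[set i : 'I_n | a <= i < b]| <= b - a)%N.
Proof.
rewrite cardE -(size_map val) -(size_iota a (b - a)); apply: uniq_leq_size.
  by rewrite map_inj_uniq ?enum_uniq //; apply: val_inj.
by move=> x /mapP[i]; rewrite mem_enum inE mem_iota => /= ? ->; lia.
Qed.

Lemma interval_partition (f : nat -> nat) (d i : nat) :
  (f 0 <= i < f d.+1)%N -> exists2 k, (k <= d)%N & (f k <= i < f k.+1)%N.
Proof.
elim: d => [|d IH] /andP[i0 id]; first by exists 0%N => //; rewrite i0.
have [lti|lei] := ltnP i (f d.+1); last by exists d.+1 => //; rewrite lei.
by have [|k kd ki] := IH _; [rewrite i0|exists k => //; apply: leqW].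
Qed.

Lemma blocks_cover (q d i : nat) : (i < q * d.+1 + 1)%N ->
  exists k, (k <= d)%N && (k * q <= i <= k.+1 * q)%N.
Proof.
(* The half-open intervals [k q, (k+1) q), the last one extended by its end. *)
move=> lti; have [|k kd /andP[ki ik]] :=
  @interval_partition (fun k => k * q + (k == d.+1))%N d i.
  by rewrite /= eqxx (mulnC d.+1).
exists k; rewrite kd (leq_trans (leq_addr _ _) ki) -ltnS.
by apply: leq_trans ik _; rewrite -[leqRHS]addn1 leq_add2l leq_b1.
Qed.

Lemma missed_part (T : finType) (P : {set {set T}}) (S : {set T}) :
  partition P [set: T] -> (#|S| < #|P|)%N -> exists2 A, A \in P & [disjoint A & S].
Proof.
move=> /and3P[/eqP cP tP _] ltSP; apply: contrapT => noA.
suff : P \subset pblock P @: S.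
  move=> /subset_leq_card; apply/negP.
  by rewrite -ltnNge (leq_ltn_trans (leq_imset_card _ _)).
apply/subsetP => A AP; have [dAS|] := boolP [disjoint A & S]; first by case: noA; exists A.
case/pred0Pn => x /andP[/= xA xS]; apply/imsetP; exists x => //.
by rewrite (def_pblock tP AP xA).
Qed.

Section Separation.
Variables (R : realType) (d q n L : nat) (Z : 'I_n -> 'rV[R]_d) (phi : nat -> 'cV[R]_d.+1).
Hypotheses (nE : n = (q * d.+1 + 1)%N) (q_gt0 : (0 < q)%N) (L_large : (q * d < L)%N).
Hypothesis phi_wide : stretched (L ^ 2) (homog \o Z) phi.
Variable P : {set {set 'I_n}}.
Hypotheses (P_part : partition P [set: 'I_n]) (P_card : #|P| = q.+1).

Let L_gt0 : 0 < L%:R :> R. Proof. by rewrite ltr0n; apply: leq_ltn_trans L_large. Qed.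

(** The k-th interval consists of the i with f k <= i < f k.+1, and Am k is a
part that misses it.  The forms psi A of the introductory comment separate the
parts. *)
Lemma separated_of_intervals (f : nat -> nat) (Am : nat -> {set 'I_n}) :
    f 0 = 0%N -> f d.+1 = n -> (forall k, (k <= d)%N -> (f k < f k.+1)%N) ->
    (forall k, (k <= d)%N -> Am k \in P) ->
    (forall k i, (k <= d)%N -> i \in Am k -> ~~ (f k <= i < f k.+1)%N) ->
  ~ exists x, forall A, A \in P -> conv_hull Z A x.
Proof.
move=> f0 fd fmono AmP Am_miss [x xP]; have [phi0 phiw] := phi_wide.
have fle a b : (a <= b <= d.+1)%N -> (f a <= f b)%N.
  move=> /andP[]; elim: b => [|b IH]; first by rewrite leqn0 => /eqP->.
  rewrite leq_eqVlt => /predU1P[->//|ab] bd.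
  by apply: leq_trans (IH ab (ltnW bd)) (ltnW (fmono b _)).
have n0 : (0 < n)%N by rewrite nE addn1.
pose b l := insubd (Ordinal n0) (f l.+1).
have bE l : (l < d)%N -> b l = f l.+1 :> nat.
  move=> ld; rewrite val_insubd ifT // -fd.
  by apply: leq_trans (fmono l.+1 ld) (fle _ _ _); rewrite !ltnS ld leqnn.
have wide2 k (i j : 'I_n) : (k < d)%N -> (i < j)%N ->
    L%:R ^+ 2 * (ev (phi k.+1) (homog (Z i)) * ev (phi k) (homog (Z j))) <=
      ev (phi k.+1) (homog (Z j)) * ev (phi k) (homog (Z i)).
  by move=> kd ij; rewrite -natrX; apply: phiw.
(* With growth L^2 and ratio L at the first point of an interval, the ratio is at
   most 1 / L at the last point of the interval before it. *)
have [lam [lam0 lamP]] := rescale phi0 wide2 b L_gt0.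
pose g k i := lam k * ev (phi k) (homog (Z i)).
have g0 k i : (k <= d)%N -> 0 < g k i by move=> kd; rewrite mulr_gt0 ?lam0 ?phi0.
have L1 : 1 <= L%:R :> R by rewrite ler1n -(ltr0n R).
have low l (i : 'I_n) : (l < d)%N -> (i < f l.+1)%N -> L%:R * g l.+1 i <= g l i.
  move=> ld li; have [_ + _] := lamP l i ld; rewrite bE // => /(_ li).
  by rewrite expr2 -mulrA ler_pM2l.
have high l (i : 'I_n) : (l < d)%N -> (f l.+1 <= i)%N -> L%:R * g l i <= g l.+1 i.
  move=> ld; rewrite leq_eqVlt => /predU1P[ib|li].
    have ib' : i = b l by apply: val_inj; rewrite /= bE.
    by have [/(_ ib') E _ _] := lamP l i ld; rewrite /g E.
  have [_ _] := lamP l i ld; rewrite bE // => /(_ li); apply: le_trans.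
  by rewrite ler_peMl ?exprn_ege1 // mulr_ge0 ?(ltW L_gt0) // ltW // g0 // ltnW.
have dom k j (i : 'I_n) : (k <= d)%N -> (j <= d)%N -> (f k <= i < f k.+1)%N -> j != k ->
    L%:R * g j i <= g k i.
  move=> kd jd /andP[ki ik]; rewrite neq_ltn => /orP[jk|kj].
    have [k' kE] : exists k', k = k'.+1 by case: (k) jk => // k' _; exists k'.
    rewrite kE; apply: le_trans (high k' i _ _); rewrite -?kE //.
    rewrite ler_pM2l //; apply: (@chain_ge R (fun l => g l i)); first by rewrite -ltnS -kE.
    move=> l /andP[jl lk]; apply: le_trans (high l i _ _); last 2 first.
    - by lia.
    - by apply: leq_trans ki; apply: fle; lia.
    by rewrite ler_peMl // ltW // g0; lia.
  have [j' jE] : exists j', j = j'.+1 by case: (j) kj => // j' _; exists j'.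
  rewrite jE; apply: le_trans (low j' i _ _) _; rewrite -?jE //.
    by apply: leq_trans ik _; apply: fle; lia.
  apply: (@chain_le R (fun l => g l i)); first by rewrite -ltnS -jE.
  move=> l /andP[kl lj]; apply: le_trans (low l i _ _); last 2 first.
  - by lia.
  - by apply: leq_trans ik _; apply: fle; lia.
  by rewrite ler_peMl // ltW // g0; lia.
pose u k A : R := if A == Am k then - q%:R else 1.
pose psi A := \sum_(k < d.+1) (u k A * lam k) *: phi k.
have psiE A y : ev (psi A) y = \sum_(k < d.+1) u k A * (lam k * ev (phi k) y).
  rewrite /ev mulmx_sumr summxE; apply: eq_bigr => k _.
  by rewrite -scalemxAr mxE mulrA.
have psi0 : \sum_(A in P) psi A = 0.
  rewrite exchange_big big1 // => k _; rewrite -scaler_suml -mulr_suml.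
  rewrite (bigD1 (Am k)) ?AmP ?leq_ord //= {1}/u eqxx.
  rewrite (eq_bigr (fun=> 1)) => [|A /andP[_ /negPf ne]]; last by rewrite /u ne.
  rewrite sumr_const (_ : #|_| = q) ?addNr ?mul0r ?scale0r //.
  have := P_card; rewrite (cardsD1 (Am k)) AmP ?leq_ord // add1n => -[<-].
  by apply: eq_card => A; rewrite !inE andbC.
have psi_pos A i : A \in P -> i \in A -> 0 < ev (psi A) (homog (Z i)).
  move=> AP iA; have [|k kd ki] := @interval_partition f d i.
    by rewrite f0 fd ltn_ord.
  have kA : A != Am k by apply: contraL ki => /eqP eA; apply: Am_miss; rewrite -?eA.
  rewrite psiE (bigD1 (Ordinal (kd : (k < d.+1)%N))) //= {1}/u (negPf kA) mul1r -/(g k i).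
  rewrite -(pmulr_rgt0 _ L_gt0) mulrDr mulr_sumr.
  have : \sum_(j < d.+1 | j != Ordinal (kd : (k < d.+1)%N)) - (q%:R * g k i) <=
     \sum_(j < d.+1 | j != Ordinal (kd : (k < d.+1)%N)) L%:R * (u j A * g j i).
    apply: ler_sum => j; rewrite -val_eqE /= => jk.
    have := dom k j i kd (leq_ord j) ki jk; have := g0 j i (leq_ord j).
    rewrite /u; case: ifP => _ gj gk.
      by rewrite mulNr mulrN lerN2 mulrCA ler_wpM2l.
    rewrite mul1r; apply: (@le_trans _ _ 0).
      by rewrite oppr_le0 mulr_ge0 // ltW // g0.
    by rewrite ltW // mulr_gt0.
  rewrite sumr_const (_ : #|_| = d); last first.
    by rewrite cardC1 card_ord.
  have gk := g0 k i kd.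
  have : (q * d)%:R * g k i < L%:R * g k i by rewrite ltr_pM2r // ltr_nat.
  rewrite natrM -mulr_natr; lra.
have pos A : A \in P -> 0 < ev (psi A) (homog x).
  move=> AP; have [w [w0 w1 xE]] := xP A AP.
  have -> : homog x = \sum_(i in A) w i *: homog (Z i) by rewrite homog_sum w1 -xE.
  rewrite ev_sum; have tge0 i : i \in A -> 0 <= w i * ev (psi A) (homog (Z i)).
    by move=> iA; rewrite mulr_ge0 ?w0 // ltW ?psi_pos.
  rewrite lt_neqAle sumr_ge0 // andbT eq_sym psumr_neq0 //.
  have : \sum_(i in A) w i != 0 by rewrite w1 oner_neq0.
  rewrite psumr_neq0 // => /hasP[i ii /andP[iA wi]]; apply/hasP; exists i => //.
  by rewrite iA mulr_gt0 ?psi_pos.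
have : \sum_(A in P) ev (psi A) (homog x) = 0.
  by rewrite /ev -summxE -mulmx_sumr psi0 mulmx0 mxE.
have A0P := AmP 0%N isT.
rewrite (bigD1 (Am 0%N)) //= => /eqP; apply/negP; rewrite gt_eqF // ltr_pwDl ?pos //.
by apply: sumr_ge0 => A /andP[AP _]; apply/ltW/pos.
Qed.

(** The intervals are the s-th block, of r points, and the pieces of r - 1 points
obtained from the other blocks by removing the end that is nearer to it. *)
Lemma no_common_point (s : nat) (A0 : {set 'I_n}) : (s <= d)%N -> A0 \in P ->
    (forall i, i \in A0 -> ~~ (s * q <= i <= s.+1 * q)%N) ->
  ~ exists x, forall A, A \in P -> conv_hull Z A x.
Proof.
move=> sd A0P A0s; pose f k := (k * q + (s < k))%N.
have /choice[Am AmP] : forall k, exists A, (k <= d)%N -> A \in P /\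
    forall i, i \in A -> ~~ (f k <= i < f k.+1)%N.
  move=> k; have [->|ks] := eqVneq k s.
    exists A0 => _; split=> // i /A0s; rewrite /f ltnn ltnSn; lia.
  have [|A AP dA] := @missed_part _ P [set i : 'I_n | (f k <= i < f k.+1)%N] P_part.
    rewrite P_card ltnS; apply: leq_trans (card_interval _ _ _) _.
    by rewrite /f mulSn; lia.
  exists A => _; split=> // i iA.
  by have /disjointFr/(_ iA)/negbT := dA; rewrite inE.
apply: (@separated_of_intervals f Am) => [|||k kd|k i kd].
- by rewrite /f.
- by rewrite /f ltnS sd nE mulnC.
- by move=> k _; rewrite /f mulSn; lia.
- by have [] := AmP k kd.
- by have [_ /(_ i)] := AmP k kd.
Qed.

End Separation.

(** * Partitions that meet every block once *)

Section CommonPoint.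
Variables (R : realType) (d q n K : nat) (Z : 'I_n -> 'rV[R]_d) (phi : nat -> 'cV[R]_d.+1).
Hypotheses (nE : n = (q * d.+1 + 1)%N) (q_gt0 : (0 < q)%N).
Hypothesis K_large : ((4 * d + 2) * n < K)%N.
Hypothesis phi_wide : stretched K (homog \o Z) phi.
Variable P : {set {set 'I_n}}.
Hypotheses (P_part : partition P [set: 'I_n]) (P_card : #|P| = q.+1).
Hypothesis P_rainbow : forall k A, (k <= d)%N -> A \in P ->
  #|A :&: [set i : 'I_n | k * q <= i <= k.+1 * q]%N| = 1%N.

(** The contributions w i * g k i of the points i of the k-th block differ from
the common sum z k by an error of relative size n / K.  Passing from one block
to the next through their shared point costs two such errors, so any two
contributions differ by at most (4 d + 2) n / K times the largest, and thus have
its sign. *)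
Lemma common_point : exists x, forall A, A \in P -> conv_hull Z A x.
Proof.
have [phi0 phiw] := phi_wide.
have n0 : (0 < n)%N by rewrite nE addn1.
pose b l := insubd (Ordinal n0) (l.+1 * q)%N.
have bE l : (l < d)%N -> b l = (l.+1 * q)%N :> nat.
  by move=> ld; rewrite val_insubd ifT // nE addn1 ltnS mulnC leq_mul2l ltnS ltnW ?orbT.
(* Ratio 1 at the shared points: consecutive forms tie there, and nowhere else. *)
have [lam [lam0 lamP]] := rescale phi0 phiw b (@ltr01 R).
pose g k i := lam k * ev (phi k) (homog (Z i)).
have g0 k i : (k <= d)%N -> 0 < g k i by move=> kd; rewrite mulr_gt0 ?lam0 ?phi0.
have Kgt0 : 0 < K%:R :> R by rewrite ltr0n; apply: leq_ltn_trans K_large.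
have K1 : 1 <= K%:R :> R by rewrite ler1n -(ltr0n R).
have low l (i : 'I_n) : (l < d)%N -> (i < l.+1 * q)%N -> K%:R * g l.+1 i <= g l i.
  by move=> ld li; have [_ + _] := lamP l i ld; rewrite bE // mul1r => /(_ li).
have high l (i : 'I_n) : (l < d)%N -> (l.+1 * q < i)%N -> K%:R * g l i <= g l.+1 i.
  by move=> ld li; have [_ _] := lamP l i ld; rewrite bE // mul1r => /(_ li).
have tie l (i : 'I_n) : (l < d)%N -> i = (l.+1 * q)%N :> nat -> g l.+1 i = g l i.
  move=> ld ib; have ib' : i = b l by apply: val_inj; rewrite /= bE.
  by have [/(_ ib') + _ _] := lamP l i ld; rewrite mul1r.
have low1 l (i : 'I_n) : (l < d)%N -> (i <= l.+1 * q)%N -> g l.+1 i <= g l i.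
  move=> ld; rewrite leq_eqVlt => /predU1P[/tie->//|/(low _ _ ld)]; apply: le_trans.
  by rewrite ler_peMl // ltW // g0.
have high1 l (i : 'I_n) : (l < d)%N -> (l.+1 * q <= i)%N -> g l i <= g l.+1 i.
  move=> ld; rewrite leq_eqVlt => /predU1P[/esym/tie->//|/(high _ _ ld)]; apply: le_trans.
  by rewrite ler_peMl // ltW // g0 // ltnW.
pose B k (i : 'I_n) := (k * q <= i <= k.+1 * q)%N.
have far k j i : (k <= d)%N -> (j <= d)%N -> B k i -> ~~ B j i -> K%:R * g j i <= g k i.
  rewrite /B => kd jd /andP[ki ik] nBj.
  have [jk|kj|ejk] := ltngtP j k; last by move: nBj; rewrite ejk ki ik.
    have ji : (j.+1 * q < i)%N.
      rewrite ltnNge; apply: contra nBj => ->; rewrite andbT.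
      by apply: leq_trans ki; rewrite leq_mul2r (ltnW jk) orbT.
    apply: le_trans (high j i _ ji) _; first exact: leq_trans jk kd.
    apply: (@chain_ge R (fun l => g l i)) => // l /andP[jl lk].
    apply: high1; first exact: leq_trans lk kd.
    by apply: leq_trans ki; rewrite leq_mul2r lk orbT.
  case: j kj jd nBj => // j; rewrite ltnS => kj jd nBj.
  have ij : (i < j.+1 * q)%N.
    rewrite ltnNge; apply: contra nBj => -> /=.
    by apply: leq_trans ik _; rewrite leq_mul2r ltnS (leqW kj) orbT.
  apply: le_trans (low j i jd ij) _.
  apply: (@chain_le R (fun l => g l i)) => // l /andP[kl lj].
  apply: low1; first by apply: ltn_trans jd.
  by apply: leq_trans ik _; rewrite leq_mul2r ltnS kl orbT.
have near k j i : (k <= d)%N -> (j <= d)%N -> B k i -> B j i -> g j i = g k i.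
  wlog : k j / (k <= j)%N => [W|].
    by have [kj|/ltnW jk] := leqP k j => *; [|apply/esym]; apply: W.
  rewrite leq_eqVlt => /predU1P[->//|kj] kd jd /andP[ki ik] /andP[ji ij].
  have ek : (j * q = k.+1 * q)%N.
    by apply/eqP; rewrite eqn_leq (leq_trans ji ik) leq_mul2r kj orbT.
  have jk : j = k.+1 by apply/eqP; rewrite -(eqn_pmul2r q_gt0) ek.
  by rewrite jk; apply: tie; [rewrite -jk|apply/eqP; rewrite eqn_leq ik -jk].
have [A0 A0P] : exists A, A \in P by apply/card_gt0P; rewrite P_card.
have [w [[i1 wi1] wP]] : exists w : 'I_n -> R, (exists i, w i != 0) /\
    forall A, A \in P -> \sum_(i in A) w i *: homog (Z i) = \sum_(i in A0) w i *: homog (Z i).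
  by apply: common_weighted_sum => //; rewrite P_card nE addn1.
pose z k := \sum_(i in A0) w i * g k i.
have zP k A : A \in P -> \sum_(i in A) w i * g k i = z k.
  move=> /wP E; rewrite /z.
  have S (C : {set 'I_n}) : \sum_(i in C) w i * g k i =
      lam k * ev (phi k) (\sum_(i in C) w i *: homog (Z i)).
    by rewrite ev_sum mulr_sumr; apply: eq_bigr => i _; rewrite /g mulrCA.
  by rewrite !S E.
have Bex i : exists k, (k <= d)%N && B k i.
  by apply: blocks_cover; rewrite -nE ltn_ord.
pose kk i := xchoose (Bex i).
have kkd i : (kk i <= d)%N by have /andP[] := xchooseP (Bex i).
have kkB i : B (kk i) i by have /andP[] := xchooseP (Bex i).
pose W i := w i * g (kk i) i.
have gkk0 i : 0 < g (kk i) i by apply: g0.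
pose im := [arg max_(i > i1) `|W i|]%O.
have Wmax i : `|W i| <= `|W im|.
  by rewrite /im; case: arg_maxP => // j _; apply.
have Wm0 : 0 < `|W im|.
  by apply: lt_le_trans (Wmax i1); rewrite normr_gt0 mulf_neq0 // gt_eqF.
set u := `|W im| in Wmax Wm0.
have est k i : (k <= d)%N -> B k i -> K%:R * `|W i - z k| <= n%:R * u.
  move=> kd ki; pose A := pblock P i.
  have AP : A \in P by rewrite pblock_mem // (cover_partition P_part) inE.
  have iA : i \in A by rewrite mem_pblock (cover_partition P_part) inE.
  rewrite -(zP k A AP) (bigD1 i) //= {1}/W (near k (kk i)) // opprD addrA subrr add0r.
  rewrite normrN -[K%:R](ger0_norm (ltW Kgt0)) -normrM mulr_sumr.
  apply: le_trans (ler_norm_sum _ _ _) _.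
  apply: (@le_trans _ _ (\sum_(j in A | j != i) u)).
    apply: ler_sum => j /andP[jA ji]; apply: le_trans (Wmax j).
    rewrite mulrCA /W [leLHS]normrM [leRHS]normrM ler_wpM2l // (ger0_norm (ltW (gkk0 j))).
    rewrite ger0_norm; last by rewrite mulr_ge0 // ltW // g0.
    apply: far => //; apply: contra ji => kj; have /eqP/cards1P[x0 xE] := P_rainbow kd AP.
    have : i \in A :&: [set i : 'I_n | k * q <= i <= k.+1 * q]%N by rewrite !inE iA.
    have : j \in A :&: [set i : 'I_n | k * q <= i <= k.+1 * q]%N by rewrite !inE jA.
    by rewrite xE !inE => /eqP-> /eqP->.
  rewrite sumr_const -[leLHS]mulr_natl; apply: ler_wpM2r; rewrite ?ler_nat ?(ltW Wm0) //.
  by apply: leq_trans (max_card _) _; rewrite card_ord.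
have step k : (k <= d)%N -> K%:R * `|z k - z 0%N| <= (2 * k * n)%:R * u.
  elim: k => [|k IH] kd; first by rewrite subrr normr0 mulr0 mul0r.
  have := IH (ltnW kd).
  have bk : B k (b k) by rewrite /B bE // leqnn andbT leq_mul2r leqnSn orbT.
  have bk1 : B k.+1 (b k) by rewrite /B bE // leqnn /= leq_mul2r leqnSn orbT.
  have := est k (b k) (ltnW kd) bk; have := est k.+1 (b k) kd bk1.
  have -> : (2 * k.+1 * n = 2 * k * n + n + n)%N by lia.
  rewrite 2!natrD 2!mulrDl.
  have : K%:R * `|z k.+1 - z 0%N| <= K%:R * `|W (b k) - z k.+1| + K%:R * `|W (b k) - z k|
     + K%:R * `|z k - z 0%N|.
    rewrite -!mulrDr ler_pM2l // (distrC (W (b k)) (z k.+1)).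
    by apply: le_trans (ler_distD (z k) _ _) _; rewrite lerD2r ler_distD.
  lra.
have close i : K%:R * `|W i - z 0%N| <= ((2 * d + 1) * n)%:R * u.
  have := est (kk i) i (kkd i) (kkB i); have := step (kk i) (kkd i).
  have : K%:R * `|W i - z 0%N| <= K%:R * `|W i - z (kk i)| + K%:R * `|z (kk i) - z 0%N|.
    by rewrite -!mulrDr ler_pM2l // ler_distD.
  have : (2 * kk i * n)%:R * u + n%:R * u <= ((2 * d + 1) * n)%:R * u.
    rewrite -mulrDl -natrD ler_pM2r // ler_nat mulnDl mul1n leq_add2r.
    by rewrite leq_mul2r leq_mul2l kkd !orbT.
  lra.
have same_sign i : 0 < W i * W im.
  have : K%:R * `|W i - W im| < K%:R * u.
    have := close i; have := close im.
    have : K%:R * `|W i - W im| <= K%:R * `|W i - z 0%N| + K%:R * `|W im - z 0%N|.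
      by rewrite -!mulrDr ler_pM2l // (distrC (W im)) ler_distD.
    have : ((2 * d + 1) * n)%:R * u + ((2 * d + 1) * n)%:R * u < K%:R * u.
      rewrite -mulrDl -natrD ltr_pM2r // ltr_nat.
      by apply: leq_ltn_trans K_large; lia.
    lra.
  rewrite ltr_pM2l // /u; have [p|p|p] := ltrgt0P (W im).
  - by rewrite ltr_norml => /andP[h _]; rewrite mulr_gt0 //; lra.
  - by rewrite ltr_norml => /andP[_ h]; rewrite -mulrNN mulr_gt0 ?oppr_gt0 //; lra.
  - by move: Wm0; rewrite /u p normr0 ltxx.
pose v i := w i * W im.
have v0 i : 0 < v i.
  by have := same_sign i; rewrite /v /W mulrAC pmulr_lgt0.
have vP A : A \in P -> \sum_(i in A) v i *: homog (Z i) = \sum_(i in A0) v i *: homog (Z i).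
  move=> /wP E; have S (C : {set 'I_n}) : \sum_(i in C) v i *: homog (Z i) =
      W im *: \sum_(i in C) w i *: homog (Z i).
    by rewrite scaler_sumr; apply: eq_bigr => i _; rewrite scalerA mulrC.
  by rewrite !S E.
pose s := \sum_(i in A0) v i.
exists (s^-1 *: \sum_(i in A0) v i *: Z i) => A AP.
have := vP A AP; rewrite !homog_sum => E; have [sE xE] := @eq_row_mx _ 1 1 d _ _ _ _ E.
have {}sE : \sum_(i in A) v i = s by have /matrixP/(_ 0 0) := sE; rewrite !mxE.
have s0 : 0 < s.
  have /set0Pn[i iA] : A != set0.
    by apply: contraTneq AP => ->; have /and3P[] := P_part.
  rewrite -sE (bigD1 i) //= ltr_pwDl ?v0 // sumr_ge0 // => j _; exact/ltW.
exists (fun i => v i / s); split.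
- by move=> i _; rewrite divr_ge0 // ltW.
- by rewrite -mulr_suml sE divff // gt_eqF.
- rewrite -xE scaler_sumr; apply: eq_bigr => i _.
  by rewrite scalerA mulrC.
Qed.

End CommonPoint.

(** * General position and rainbow blocks *)

Section GeneralPosition.
Variables (R : realType) (d N : nat) (p : 'I_N -> 'rV[R]_d).

(** All differences of points of the hull lie in the span of the vectors
p i - p c, so any flat equal to the hull has its direction in that span. *)
Lemma aff_dim_aff_hull_lt (C : {set 'I_N}) : C != set0 ->
  aff_dim (aff_hull p C) < #|C|%:Z.
Proof.
move=> /set0Pn[c cC]; pose W := <<[seq p i - p c | i <- enum (C :\ c)]>>%VS.
have inW x : aff_hull p C x -> x - p c \in W.
  move=> [w [w1 ->]]; rewrite -[p c]scale1r -w1 scaler_suml -sumrB.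
  apply: memv_suml => i iC; rewrite -scalerBr; apply: memvZ.
  have [->|ic] := eqVneq i c; first by rewrite subrr mem0v.
  by apply/memv_span/mapP; exists i; rewrite // mem_enum !inE ic.
have dimW : (\dim W < #|C|)%N.
  apply: leq_ltn_trans (dim_span _) _.
  by rewrite size_map -cardE [leqRHS](cardsD1 c) cC.
rewrite /aff_dim; case: ifP => // _; rewrite ltz_nat.
case: xgetP => [V _ [a aE]|_]; last by rewrite dimv0; apply: leq_ltn_trans dimW.
apply: leq_ltn_trans dimW; apply/dimvS/subvP => v vV.
have flatV y : y - a \in V -> y - p c \in W by move=> h; apply: inW; rewrite aE.
have -> : v = (v + a - p c) - (a - p c) by rewrite opprB addrA subrK addrK.
by apply: memvB; apply: flatV; rewrite ?addrK // subrr mem0v.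
Qed.

Lemma aff_hull_set1 (a : 'I_N) : aff_hull p [set a] = flat (p a) 0%VS.
Proof.
apply/seteqP; split=> x.
  by move=> [w []]; rewrite !big_set1 => -> ->; rewrite scale1r /flat /= subrr mem0v.
rewrite /flat /= memv0 subr_eq0 => /eqP->; exists (fun=> 1).
by rewrite !big_set1 scale1r.
Qed.

(** The flats of {a} and C would meet in a point, of codimension d, although
their codimensions d and at least 1 add up to d + 1 or more. *)
Lemma strong_general_position_aff_hull (a : 'I_N) (C : {set 'I_N}) :
  strong_general_position p -> a \notin C -> (#|C| <= d)%N -> ~ aff_hull p C (p a).
Proof.
move=> gp aC Cd pa; pose S (j : 'I_2) := if j == 0 then [set a] else C.
have C0 : C != set0.
  apply/eqP => E; case: pa => w [+ _]; rewrite E big_set0 => /eqP.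
  by rewrite eq_sym oner_eq0.
have := gp 2 S isT; rewrite big_ord_recl big_ord1 /S /=.
have -> : (\bigcap_(j in [set: 'I_2]) aff_hull p (S j) = flat (p a) 0%VS)%classic.
  rewrite -aff_hull_set1; apply/seteqP; split=> x; first by move/(_ ord0 I).
  rewrite aff_hull_set1 /flat /= memv0 subr_eq0 => /eqP-> j _.
  rewrite /S; case: ifP => // _; rewrite aff_hull_set1 /flat /=.
  by rewrite subrr mem0v.
rewrite aff_hull_set1 aff_dim_flat dimv0 subr0 => H.
have lt := aff_dim_aff_hull_lt C0.
have /H : forall i j, i != j -> [disjoint S i & S j]%bool.
  move=> i j; rewrite /S; case: ifP => [/eqP->|i0]; case: ifP => [/eqP->|j0] ij.
  - by case/eqP: ij.
  - by rewrite disjoints1.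
  - by rewrite disjoint_sym disjoints1.
  - by case: i j i0 j0 ij => [[|[|]]//= ?] [[|[|]]//= ?] //; rewrite -val_eqE.
have Cd' : #|C|%:Z <= d%:Z by rewrite lez_nat.
by rewrite minElt; case: ifP; lia.
Qed.

(** A linear dependence between lifted points is an affine dependence, which
expresses one of the points by the d others. *)
Lemma bracket_neq0 (u : seq 'I_N) : strong_general_position p -> uniq u -> size u = d.+1 ->
  bracket (map (homog \o p) u) != 0.
Proof.
move=> gp uu szu; apply/negP => /det0P[v v0 vM].
have x0 : 'I_N by case: (u) szu.
pose U := [set x in u]; pose w x := v 0 (inord (index x u)).
have wE : \sum_(x in U) w x *: homog (p x) = 0.
  apply: etrans vM; rewrite (eq_bigl [in u]); last by move=> x; rewrite inE.
  rewrite -big_uniq // (big_nth x0) szu big_mkord.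
  apply/rowP => k; rewrite summxE [RHS]mxE; apply: eq_bigr => i _.
  rewrite [LHS]mxE [fun_of_matrix (\matrix__ _) _ _]mxE (nth_map x0) ?szu //= /w.
  by rewrite index_uniq ?szu // inord_val.
have := wE; rewrite homog_sum => wE'.
have [w0 wp] : \sum_(x in U) w x = 0 /\ \sum_(x in U) w x *: p x = 0.
  have [|E1 E2] := @eq_row_mx _ 1 1 d _ _ 0 0 (etrans wE' _).
    by rewrite row_mx0.
  by split=> //; have /matrixP/(_ 0 0) := E1; rewrite !mxE.
have /rV0Pn[i vi] := v0; pose a := nth x0 u i.
have aU : a \in U by rewrite inE mem_nth // szu.
have wa : w a != 0 by rewrite /w /a index_uniq ?szu // inord_val.
apply: (@strong_general_position_aff_hull a (U :\ a) gp).
- by rewrite !inE eqxx.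
- have := cardsD1 a U; rewrite aU cardsE; move/card_uniqP: uu => ->; rewrite szu.
  by rewrite add1n => -[->].
exists (fun x => - w x / w a); split.
  rewrite -mulr_suml sumrN; apply/eqP; rewrite -[_ == 1](inj_eq (mulIf wa)).
  rewrite divfK // mul1r; move/eqP: w0; rewrite (big_setD1 a) //= addrC addr_eq0.
  by move/eqP->; rewrite opprK.
apply/(scalerI wa); rewrite scaler_sumr; move/eqP: wp; rewrite (big_setD1 a) //=.
rewrite addr_eq0 => /eqP->; rewrite -sumrN; apply: eq_bigr => x _.
by rewrite scalerA mulrC divfK // scaleNr.
Qed.

End GeneralPosition.

Lemma sum_card_parts (T : finType) (P : {set {set T}}) (S : {set T}) :
  partition P [set: T] -> (\sum_(A in P) #|A :&: S| = #|S|)%N.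
Proof.
move=> /and3P[/eqP cP tP _].
rewrite -[S in RHS]setTI -cP -sum1_card.
rewrite (eq_bigl (fun x => (x \in cover P) && (x \in S))); last by move=> x; rewrite inE.
rewrite big_trivIset_cond //; apply: eq_bigr => A _.
by rewrite -sum1_card; apply: eq_bigl => x; rewrite inE.
Qed.

Section RainbowBlocks.
Variables r d : nat.
Local Notation n := (tverberg_number r d).
Variable P : {set {set 'I_n}}.
Hypotheses (P_part : partition P [set: 'I_n]) (P_card : #|P| = r) (r_gt0 : (0 < r)%N).

(** A block has at most r points, so if each of the r parts meets it, each meets
it in a single point; as d + 1 blocks cover everything, parts then have at most
d + 1 points. *)
Lemma non_rainbow_block : ~~ rainbow_partition P ->
  exists s : 'I_(d + 1), exists2 A, A \in P & [disjoint A & block r s].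
Proof.
move=> nrb; apply: contrapT => noA; case/negP: nrb.
have meets (s : 'I_(d + 1)) A : A \in P -> (0 < #|A :&: block r s|)%N.
  move=> AP; rewrite card_gt0; apply/negP; rewrite setI_eq0 => dA.
  by apply: noA; exists s, A.
have card_block (s : 'I_(d + 1)) : (#|block r s| <= r)%N.
  have -> : block r s = [set i : 'I_n | s * (r - 1) <= i < ((s + 1) * (r - 1)).+1]%N.
    by apply/setP => i; rewrite !inE.
  by apply: leq_trans (card_interval _ _ _) _; rewrite mulnDl; lia.
have one (s : 'I_(d + 1)) A : A \in P -> #|A :&: block r s| = 1%N.
  move=> AP; apply/eqP; rewrite eqn_leq meets // andbT leqNgt; apply/negP => two.
  have : (\sum_(B in P) 1 < \sum_(B in P) #|B :&: block r s|)%N.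
    rewrite (bigD1 A) //= [ltnRHS](bigD1 A) //= -addSn.
    by apply: leq_add => //; apply: leq_sum => B /andP[BP _]; apply: meets.
  rewrite sum1_card P_card ltnNge; apply/negP/negPn.
  apply: leq_trans (card_block s).
  by rewrite sum_card_parts.
apply/andP; split; last by apply/forall_inP => A AP; apply/forallP => s; rewrite one.
rewrite /proper_partition P_part /=; apply/forall_inP => A AP; apply/andP; split.
  rewrite card_gt0; apply: contraTneq AP => ->.
  by have /and3P[] := P_part.
have cov (i : 'I_n) : exists s, i \in block r s.
  have [k /andP[kd ki]] : exists k, (k <= d)%N && (k * (r - 1) <= i <= k.+1 * (r - 1))%N.
    by apply: blocks_cover; rewrite -[d.+1]addn1 ltn_ord.
  have kd' : (k < d + 1)%N by rewrite addn1.
  by exists (Ordinal kd'); rewrite inE /= addn1.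
have -> : (d + 1 = \sum_(s < d + 1) #|A :&: block r s|)%N.
  by rewrite (eq_bigr (fun=> 1%N)) ?sum_nat_const ?card_ord ?muln1 // => s _; apply: one.
have E (s : 'I_(d + 1)) : #|A :&: block r s| = (\sum_(i in A) (i \in block r s))%N.
  rewrite -sum1_card big_mkcond [RHS]big_mkcond; apply: eq_bigr => i _ /=.
  by rewrite inE; case: (i \in A); case: (i \in _).
under eq_bigr do rewrite E.
rewrite exchange_big -sum1_card; apply: leq_sum => i _; have [s si] := cov i.
by rewrite (bigD1 s) //= si.
Qed.

End RainbowBlocks.

Theorem theorem1p7 (R : realType) (d r m : nat)
    (hd : (1 <= d)%N) (hr : (2 <= r)%N) (hm : (tverberg_number r d <= m)%N) :
  exists N : nat, forall p : 'I_N -> 'rV[R]_d, strong_general_position p ->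
  exists f : 'I_m -> 'I_N, increasing f /\
  forall g : 'I_(tverberg_number r d) -> 'I_m, increasing g ->
  forall P : {set {set 'I_(tverberg_number r d)}},
    partition P [set: 'I_(tverberg_number r d)] -> #|P| = r ->
    (tverberg_partition (fun i => p (f (g i))) P <-> rainbow_partition P).
Proof.
set n := tverberg_number r d; pose q := (r - 1)%N.
have q0 : (0 < q)%N by rewrite subn_gt0.
have rq : r = q.+1 by rewrite /q subn1 prednK // ltnW.
have nE : n = (q * d.+1 + 1)%N by rewrite -[d.+1]addn1.
(* Growth L^2 serves both directions: L exceeds q * d, which lets phi_k outweigh
   the d other forms with coefficients -q, and L^2 exceeds (4 d + 2) n. *)
pose L := ((4 * d + 2) * n).+1; have L0 : (0 < L ^ 2)%N by rewrite expn_gt0.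
have [N NP] := @stretched_subsequence R d (L ^ 2) m L0.
exists N => p gp; have [u uu szu|f [f_incr [phi [phi0 phiw]]]] := NP (homog \o p).
  exact: bracket_neq0.
exists f; split=> // g g_incr P P_part P_card.
pose Z i := p (f (g i)).
have phi_wide : stretched (L ^ 2) (homog \o Z) phi.
  by split=> [k i|k i j kd ij]; [apply: phi0|apply: phiw => //; apply: g_incr].
have P_card' : #|P| = q.+1 by rewrite P_card.
split=> [[_ [x xP]]|rb].
  apply/negPn/negP => /(non_rainbow_block P_part P_card (ltnW hr))[s [A AP dA]].
  have L_large : (q * d < L)%N by rewrite /L nE; nia.
  have sd : (s <= d)%N by rewrite -ltnS; apply: leq_trans (ltn_ord s) _; rewrite addn1.
  have [] := no_common_point nE q0 L_large phi_wide P_part P_card' sd AP; last by exists x.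
  by move=> i iA; have /negbT := disjointFr dA iA; rewrite inE (addn1 s).
split=> //; have L_large : ((4 * d + 2) * n < L ^ 2)%N.
  by rewrite expnS expn1 (leq_trans (ltnSn _)) // leq_pmulr.
have [|x xP] := common_point nE q0 L_large phi_wide P_part P_card'; last by exists x.
move=> k A kd AP; case/andP: rb => _ /forall_inP/(_ A AP)/forallP h.
have kd' : (k < d + 1)%N by rewrite addn1.
by have /eqP := h (Ordinal kd'); rewrite /block /= addn1.
Qed.
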